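(* Let $k$ be a finite field of characteristic $p$. For every integer $n\geq 1$ let $C^{(n)}$ be the representation of $\mathrm{GL}_n(k)$ over $\overline{\mathbf F}_p$ induced from the trivial character of the subgroup $U^{(n)}$ of upper triangular unipotent matrices, and let $H^{(n)}=\mathrm{End}_{\mathrm{GL}_n(k)}(C^{(n)})$. If there exists an integer $n_0\geq 1$ such that the $H^{(n_0)}$-module $C^{(n_0)}$ is not flat, then for every $n\geq n_0$ the $H^{(n)}$-module $C^{(n)}$ is not flat.
   Context: $\overline{\mathbf F}_p$ is an algebraic closure of $k$. $C^{(n)}$ is the space of functions $\mathrm{GL}_n(k)\to\overline{\mathbf F}_p$ invariant under left translations by $U^{(n)}$, with $\mathrm{GL}_n(k)$ acting by right translations; it is a left $H^{(n)}$-module. *)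

(* Defs.v *)
From HB Require Import structures.
From mathcomp Require Import all_boot all_order all_fingroup all_algebra.
From mathcomp Require Import boolp functions.
From mathcomp Require Import generic_quotient ring_quotient.
From mathcomp Require Import freeg.

Set Implicit Arguments.
Unset Strict Implicit.
Unset Printing Implicit Defensive.

Import GRing.Theory.
Local Open Scope ring_scope.
Local Open Scope quotient_scope.

(* Tensor product of a right module [M] and a left module [C] over a ring that
   need not be commutative: the free abelian group on [M * C] modulo the
   subgroup generated by the balanced biadditivity relations.
   A right [R]-module is a left module over the converse ring [R^c], so that
   [(a : R^c) *: m] is the product [m a]. *)
Section Tensor.
Variables (R : pzRingType) (M : lmodType R^c) (C : lmodType R).

Definition tensor_free := {freeg (M * C)%type / int}.
HB.instance Definition _ := GRing.Lmodule.on tensor_free.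

Definition free_pure (m : M) (c : C) : tensor_free := << (m, c) >>.

Inductive tensor_rel : tensor_free -> Prop :=
| TensorRel0 : tensor_rel 0
| TensorRelB x y : tensor_rel x -> tensor_rel y -> tensor_rel (x - y)
| TensorRelDl m1 m2 c :
    tensor_rel (free_pure (m1 + m2) c - (free_pure m1 c + free_pure m2 c))
| TensorRelDr m c1 c2 :
    tensor_rel (free_pure m (c1 + c2) - (free_pure m c1 + free_pure m c2))
| TensorRelZ m (a : R) c :
    tensor_rel (free_pure ((a : R^c) *: m) c - free_pure m (a *: c)).

Definition tensor_relb : pred tensor_free := fun x => `[< tensor_rel x >].

Lemma tensor_relb_zmod_closed : zmod_closed tensor_relb.
Proof.
split=> [|x y /asboolP xR /asboolP yR]; apply/asboolP.
  exact: TensorRel0.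
exact: TensorRelB.
Qed.

HB.instance Definition _ :=
  GRing.isZmodClosed.Build tensor_free tensor_relb tensor_relb_zmod_closed.

Definition tensor := Quotient.quot (GRing.ZmodClosed.clone _ tensor_relb _).
HB.instance Definition _ := GRing.Zmodule.on tensor.
HB.instance Definition _ := Quotient.on tensor.

Definition tensor_pi (x : tensor_free) : tensor := \pi_tensor x.

Definition pure_tensor (m : M) (c : C) : tensor := tensor_pi (free_pure m c).

Lemma tensor_pi_zmod_morphism : zmod_morphism tensor_pi.
Proof. by move=> x y; rewrite /tensor_pi !raddfB. Qed.

HB.instance Definition _ := GRing.isZmodMorphism.Build
  tensor_free tensor tensor_pi tensor_pi_zmod_morphism.

Lemma tensor_pi_eq x y : tensor_pi x = tensor_pi y <-> tensor_rel (x - y).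
Proof.
rewrite (rwP eqP) (rwP (asboolP (tensor_rel (x - y)))).
have -> : `[< tensor_rel (x - y) >] = (x - y \in tensor_relb) by [].
by rewrite Quotient.idealrBE.
Qed.

Lemma pure_tensorDl m1 m2 c :
  pure_tensor (m1 + m2) c = pure_tensor m1 c + pure_tensor m2 c.
Proof. by rewrite -raddfD; apply/tensor_pi_eq; exact: TensorRelDl. Qed.

Lemma pure_tensorDr m c1 c2 :
  pure_tensor m (c1 + c2) = pure_tensor m c1 + pure_tensor m c2.
Proof. by rewrite -raddfD; apply/tensor_pi_eq; exact: TensorRelDr. Qed.

Lemma pure_tensorZ m (a : R) c :
  pure_tensor ((a : R^c) *: m) c = pure_tensor m (a *: c).
Proof. by apply/tensor_pi_eq; exact: TensorRelZ. Qed.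

Section Universal.
Variables (A : zmodType) (beta : M -> C -> A).
Hypothesis betaDl : forall m1 m2 c, beta (m1 + m2) c = beta m1 c + beta m2 c.
Hypothesis betaDr : forall m c1 c2, beta m (c1 + c2) = beta m c1 + beta m c2.
Hypothesis betaZ : forall m (a : R) c,
  beta ((a : R^c) *: m) c = beta m (a *: c).

Let free_lift (x : tensor_free) : A :=
  fglift (fun mc : M * C => beta mc.1 mc.2 : zmodule A) x.

Let free_lift_pure m c : free_lift (free_pure m c) = beta m c.
Proof. by rewrite /free_lift /free_pure liftU scale1r. Qed.

Let free_liftB x y : free_lift (x - y) = free_lift x - free_lift y.
Proof. exact: (@lift_is_additive _ _ (zmodule A)). Qed.

Let free_liftD x y : free_lift (x + y) = free_lift x + free_lift y.
Proof. have {1}-> : x + y = x - (0 - y) by rewrite sub0r opprK.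
by rewrite !free_liftB -{1}(subrr (0 : tensor_free)) free_liftB addrN sub0r opprK. Qed.

Let free_lift_rel x : tensor_rel x -> free_lift x = 0.
Proof.
elim=> [|{}x y _ xR _ yR|m1 m2 c|m c1 c2|m a c].
- by rewrite -(subrr (0 : tensor_free)) free_liftB addrN.
- by rewrite free_liftB xR yR subrr.
- by rewrite free_liftB free_liftD !free_lift_pure betaDl subrr.
- by rewrite free_liftB free_liftD !free_lift_pure betaDr subrr.
- by rewrite free_liftB !free_lift_pure betaZ subrr.
Qed.

Lemma tensor_universal : exists phi : {additive tensor -> A},
  forall m c, phi (pure_tensor m c) = beta m c.
Proof.
pose phi (t : tensor) := free_lift (repr t).
have phi_pi x : phi (tensor_pi x) = free_lift x.
  apply/eqP; rewrite -subr_eq0 -free_liftB; apply/eqP/free_lift_rel.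
  by apply/tensor_pi_eq; rewrite /tensor_pi reprK.
have phiB : zmod_morphism phi.
  move=> t u; rewrite -[t]reprK -[u]reprK.
  by rewrite -[\pi _ - \pi _]tensor_pi_zmod_morphism !phi_pi free_liftB.
pose phiM := GRing.isZmodMorphism.Build tensor A phi phiB.
pose phiA : {additive tensor -> A} := HB.pack phi phiM.
by exists phiA => m c; rewrite [LHS]phi_pi free_lift_pure.
Qed.
End Universal.

Lemma tensor_gen t : exists s : seq (int * (M * C)),
  t = \sum_(x <- s) pure_tensor x.2.1 x.2.2 *~ x.1.
Proof.
exists [seq (coeff x (repr t), x) | x <- dom (repr t)].
rewrite big_map -[t in LHS]reprK -[\pi _]/(tensor_pi _).
rewrite -[repr t in LHS]freeg_sumE raddf_sum; apply: eq_bigr => -[m c] _ /=.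
by rewrite /pure_tensor /free_pure -raddfMz freegU_mulz intz.
Qed.

End Tensor.

Section TensorMap.
Variables (R : pzRingType) (M N : lmodType R^c) (C : lmodType R).
Variable f : {linear M -> N}.

Definition free_map (x : tensor_free M C) : tensor_free N C :=
  fglift (fun mc : M * C => free_pure (f mc.1) mc.2) x.

Definition tensor_map (t : tensor M C) : tensor N C :=
  tensor_pi (free_map (repr t)).

Lemma free_map_zmod_morphism : zmod_morphism free_map.
Proof. exact: lift_is_additive. Qed.

HB.instance Definition _ := GRing.isZmodMorphism.Build
  (tensor_free M C) (tensor_free N C) free_map free_map_zmod_morphism.

Lemma free_map_pure m c : free_map (free_pure m c) = free_pure (f m) c.
Proof. by rewrite /free_map /free_pure liftU scale1r. Qed.

Lemma free_map_rel x : tensor_rel x -> tensor_rel (free_map x).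
Proof.
elim=> [|{}x y _ xR _ yR|m1 m2 c|m c1 c2|m a c].
- by rewrite raddf0; exact: TensorRel0.
- by rewrite raddfB; exact: TensorRelB.
- by rewrite raddfB raddfD /= !free_map_pure raddfD; exact: TensorRelDl.
- by rewrite raddfB raddfD /= !free_map_pure; exact: TensorRelDr.
- by rewrite raddfB /= !free_map_pure linearZ; exact: TensorRelZ.
Qed.

Lemma tensor_map_pi x : tensor_map (tensor_pi x) = tensor_pi (free_map x).
Proof.
apply/tensor_pi_eq; rewrite -raddfB; apply: free_map_rel.
by apply/tensor_pi_eq; rewrite /tensor_pi reprK.
Qed.

Lemma tensor_map_pure m c :
  tensor_map (pure_tensor m c) = pure_tensor (f m) c.
Proof. by rewrite tensor_map_pi free_map_pure. Qed.

Lemma tensor_map_zmod_morphism : zmod_morphism tensor_map.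
Proof.
move=> t u; rewrite -[t]reprK -[u]reprK -[\pi _ - \pi _]tensor_pi_zmod_morphism.
by rewrite tensor_map_pi !raddfB /= -!tensor_map_pi.
Qed.

HB.instance Definition _ := GRing.isZmodMorphism.Build
  (tensor M C) (tensor N C) tensor_map tensor_map_zmod_morphism.

End TensorMap.

(* The functor [- (x)_R C] on right [R]-modules preserves injectivity. *)
Definition flat_module (R : pzRingType) (C : lmodType R) : Prop :=
  forall (M N : lmodType R^c) (f : {linear M -> N}),
    injective f -> injective (@tensor_map R M N C f).

(* The ring End_G(V) of a [K]-linear representation [act] of [G] on [V]: the
   [K]-linear maps commuting with the action, with pointwise addition and
   composition [f * g = f \o g] as product. *)
Section EquivariantEnd.
Variables (K : fieldType) (V : lmodType K) (G : Type).
Variable act : G -> {linear V -> V}.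

Definition equivariant : pred (V -> V) := fun f =>
  `[< linear f /\ forall g v, f (act g v) = act g (f v) >].

Lemma equivariant_zmod_closed : zmod_closed equivariant.
Proof.
split=> [|f h /asboolP[fl fe] /asboolP[hl he]]; apply/asboolP; split.
- by move=> a u v; rewrite /GRing.zero /= scaler0 addr0.
- by move=> g v; rewrite /GRing.zero /= linear0.
- move=> a u v; change (f (a *: u + v) - h (a *: u + v) =
    a *: (f u - h u) + (f v - h v)).
  by rewrite fl hl scalerBr opprD addrACA.
- by move=> g v; change (f (act g v) - h (act g v) = act g (f v - h v));
    rewrite fe he linearB.
Qed.

HB.instance Definition _ := GRing.isZmodClosed.Build (V -> V) equivariant
  equivariant_zmod_closed.

Record equiv_end := EquivEnd {
  equiv_end_fun :> V -> V;
  equiv_endP : equivariant equiv_end_fun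
}.

HB.instance Definition _ := [isSub for equiv_end_fun].
HB.instance Definition _ := [Choice of equiv_end by <:].
HB.instance Definition _ := [SubChoice_isSubZmodule of equiv_end by <:].

Implicit Types f h : equiv_end.

Lemma equiv_end_linear f : linear f.
Proof. by have /asboolP[] := equiv_endP f. Qed.

Lemma equiv_end_act f g v : f (act g v) = act g (f v).
Proof. by have /asboolP[_] := equiv_endP f. Qed.

Lemma equiv_end_eq f h : f =1 h -> f = h.
Proof. by move=> fh; apply/val_inj/funext. Qed.

Lemma equivariant_id : equivariant id.
Proof. exact/asboolP. Qed.

Lemma equivariant_comp f h : equivariant (f \o h).
Proof.
apply/asboolP; split=> [a u v|g v] /=; first by rewrite !equiv_end_linear.
by rewrite !equiv_end_act.
Qed.

Definition equiv_end_one := EquivEnd equivariant_id.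
Definition equiv_end_mul f h := EquivEnd (equivariant_comp f h).

Fact equiv_end_mulA : associative equiv_end_mul.
Proof. by move=> f g h; exact: equiv_end_eq. Qed.
Fact equiv_end_mul1l : left_id equiv_end_one equiv_end_mul.
Proof. by move=> f; exact: equiv_end_eq. Qed.
Fact equiv_end_mul1r : right_id equiv_end_one equiv_end_mul.
Proof. by move=> f; exact: equiv_end_eq. Qed.
Fact equiv_end_mulDl : left_distributive equiv_end_mul +%R.
Proof. by move=> f g h; exact: equiv_end_eq. Qed.
Fact equiv_end_mulDr : right_distributive equiv_end_mul +%R.
Proof.
move=> f g h; apply: equiv_end_eq => v.
have /(_ 1 (g v) (h v)) := equiv_end_linear f.
by rewrite !scale1r.
Qed.

HB.instance Definition _ := GRing.Zmodule_isPzRing.Build equiv_end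
  equiv_end_mulA equiv_end_mul1l equiv_end_mul1r
  equiv_end_mulDl equiv_end_mulDr.

(* [V] as a left End_G(V)-module under evaluation: an alias, because [V] is
   already a [K]-module, whose body mentions [act] so that the ring of scalars
   can be inferred from it. *)
Definition end_module : Type := let _ := act in V.
HB.instance Definition _ := GRing.Zmodule.copy end_module V.

Definition end_eval (f : equiv_end) (v : end_module) : end_module := f v.

Fact end_evalA f h v : end_eval f (end_eval h v) = end_eval (f * h) v.
Proof. by []. Qed.
Fact end_eval1 : left_id 1 end_eval.
Proof. by []. Qed.
Fact end_evalDr : right_distributive end_eval +%R.
Proof.
move=> f u v; have /(_ 1 u v) := equiv_end_linear f.
by rewrite !scale1r.
Qed.
Fact end_evalDl v : {morph end_eval^~ v : f h / f + h}.
Proof. by []. Qed.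

HB.instance Definition _ := GRing.Zmodule_isLmodule.Build equiv_end end_module
  end_evalA end_eval1 end_evalDr end_evalDl.

End EquivariantEnd.

(* [{'GL_n[k]}] consists of invertible matrices of size [n.-1.+1], so it is the
   group GL_n(k) for [n >= 1]. *)
Section UnipotentInduction.
Variables (k : finFieldType) (K : fieldType) (n : nat).

Definition upper_unipotent : {set {'GL_n[k]}} :=
  [set u | [forall i : 'I_n.-1.+1, forall j : 'I_n.-1.+1,
    ((j < i)%N ==> (GLval u i j == 0)) && ((i == j) ==> (GLval u i j == 1))]].

Definition left_invariant : pred {ffun {'GL_n[k]} -> K^o} := fun f =>
  [forall u in upper_unipotent, forall g, f (u * g)%g == f g].

Lemma left_invariantP (f : {ffun {'GL_n[k]} -> K^o}) :
  reflect (forall u g, u \in upper_unipotent -> f (u * g)%g = f g)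
          (left_invariant f).
Proof.
apply: (iffP forall_inP) => [fU u g uU|fU u uU]; last first.
  by apply/forallP => g; rewrite fU.
by apply/eqP; move: (fU u uU) => /forallP.
Qed.

Lemma left_invariant_submod_closed : submod_closed left_invariant.
Proof.
split=> [|a f h /left_invariantP fU /left_invariantP hU];
  apply/left_invariantP => u g uU; rewrite !ffunE //.
by rewrite fU ?hU.
Qed.

HB.instance Definition _ := GRing.isSubmodClosed.Build K
  {ffun {'GL_n[k]} -> K^o} left_invariant left_invariant_submod_closed.

Record ind_rep := IndRep {
  ind_rep_fun :> {ffun {'GL_n[k]} -> K^o};
  ind_repP : left_invariant ind_rep_fun
}.

HB.instance Definition _ := [isSub for ind_rep_fun].
HB.instance Definition _ := [Choice of ind_rep by <:].
HB.instance Definition _ := [SubChoice_isSubLmodule of ind_rep by <:].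

Lemma right_translate_subproof (g : {'GL_n[k]}) (f : ind_rep) :
  left_invariant [ffun x => f (x * g)%g].
Proof.
apply/left_invariantP => u x uU; rewrite !ffunE -mulgA.
by have /left_invariantP /(_ u _ uU) -> := ind_repP f.
Qed.

Definition right_translate (g : {'GL_n[k]}) (f : ind_rep) : ind_rep :=
  IndRep (right_translate_subproof g f).

Fact right_translate_linear g : linear (right_translate g).
Proof. by move=> a f h; apply/val_inj/ffunP => x; rewrite !ffunE. Qed.

HB.instance Definition _ g := GRing.isLinear.Build K ind_rep ind_rep *:%R
  (right_translate g) (right_translate_linear g).

Definition right_action (g : {'GL_n[k]}) : {linear ind_rep -> ind_rep} :=
  right_translate g.

Definition hecke : pzRingType := equiv_end right_action.

Definition hecke_module : lmodType hecke := end_module right_action.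
End UnipotentInduction.

(* Main.v *)
From HB Require Import structures.
Require Import Defs.
From mathcomp Require Import all_boot all_fingroup all_algebra.
From mathcomp Require Import boolp.

(** It suffices to show that flatness in rank n + 1 implies flatness in rank n.
    Let G = GL_n(k), G' = GL_(n+1)(k), with unipotent groups U, U', modules C, D
    and Hecke algebras A, B. Embed G in G' as the matrices diag(1, x) and let P
    be the subgroup of matrices whose first column is the first basis vector;
    P is U' G, and U' \ P = U \ G.

    Hence D = Ind_P C, with C inflated to P. Functoriality of induction gives a
    ring map A -> B ([hecke_embed]) for which the restriction of functions to P
    and the extension by zero from P are A-linear, so C is a direct summand of
    the A-module D ([extend0Z], [extend0K]).

    Moreover B is a free left A-module. By Frobenius reciprocity B is the space
    of U'-invariants of D, and A that of U-invariants of C ([hecke_eq],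
    [frobenius_indicator]). An invariant of Ind_P C is given by its values at
    representatives d of P \ G' / U'. When d is a scaled cycle matrix,
    increasing off one index, the value at d is an arbitrary U-invariant of C
    ([rep_conj_unipotent], [rep_disjoint], [rep_cover]), so that B = A^I
    ([coord_sum], [coord_basis]).

    Finally, if f : M -> N is an injection of right A-modules and D is flat over
    B, then f (x) C is a restriction of the injection (f (x)_A B) (x)_B D, since
    B is free over A and C is a summand of D ([flat_descent]). *)

Set Implicit Arguments.
Unset Strict Implicit.
Unset Printing Implicit Defensive.

Import GRing.Theory.
Local Open Scope ring_scope.

(** * Descent of flatness along a free ring extension *)

(** The maps phi and coord make B a left A-module by a *: x = phi a * x, free
    with basis b. *)
Section FreeExtension.
Variables (A B : pzRingType) (phi : A -> B) (I : finType).
Variables (b : I -> B) (coord : I -> {additive B -> A}).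
Hypothesis coordM : forall i a x, coord i (phi a * x) = a * coord i x.
Hypothesis coordK : forall x, x = \sum_i phi (coord i x) * b i.
Hypothesis coord_basis : forall i j, coord i (b j) = (i == j)%:R.

(** Coordinates of x y from those of x; associativity of the right action of B
    on M (x)_A B = M^I reduces to this identity. *)
Lemma sum_coord j x y :
  \sum_i coord i x * coord j (b i * y) = coord j (x * y).
Proof.
rewrite [x in RHS]coordK mulr_suml raddf_sum; apply: eq_bigr => i _.
by rewrite -mulrA coordM.
Qed.

Section Extend.
Variable M : lmodType A^c.

(** A model of M (x)_A B: as B is left free on the b i, an element is a family
    m standing for the sum of the m i (x) b i. *)
Definition base_ext : Type := {ffun I -> M}.
HB.instance Definition _ := GRing.Zmodule.copy base_ext {ffun I -> M}.

(** (m i (x) b i) x = m i (x) (b i x), expanded back on the basis. *)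
Definition base_ext_scale (x : B^c) (m : base_ext) : base_ext :=
  [ffun j => \sum_i (coord j (b i * (x : B)) : A^c) *: (m : {ffun I -> M}) i].

Fact base_ext_scaleA x y m :
  base_ext_scale x (base_ext_scale y m) = base_ext_scale (x * y) m.
Proof.
apply/ffunP => j; rewrite !ffunE.
under eq_bigr => i _ do rewrite ffunE scaler_sumr.
rewrite exchange_big; apply: eq_bigr => i _ /=.
under eq_bigr => l _ do rewrite scalerA.
rewrite -scaler_suml; congr (_ *: _).
change (\sum_l coord l (b i * (y : B)) * coord j (b l * (x : B))
  = coord j (b i * ((y : B) * (x : B)))).
by rewrite sum_coord mulrA.
Qed.

Fact base_ext_scale1 : left_id (1 : B^c) base_ext_scale.
Proof.
move=> m; apply/ffunP => j; rewrite !ffunE (bigD1 j) //= big1 => [|i ij].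
  by rewrite (mulr1 (b j : B)) coord_basis eqxx scale1r addr0.
by rewrite (mulr1 (b i : B)) coord_basis eq_sym (negPf ij) scale0r.
Qed.

Fact base_ext_scaleDr : right_distributive base_ext_scale +%R.
Proof.
move=> x m m'; apply/ffunP => j; rewrite !ffunE -big_split /=.
by apply: eq_bigr => i _; rewrite ffunE scalerDr.
Qed.

Fact base_ext_scaleDl m : {morph base_ext_scale^~ m : x y / x + y}.
Proof.
move=> x y; apply/ffunP => j; rewrite !ffunE -big_split /=.
by apply: eq_bigr => i _; rewrite (mulrDr (b i : B)) raddfD /= scalerDl.
Qed.

Definition base_ext_lmod : lmodType B^c := HB.pack base_ext
  (GRing.Zmodule_isLmodule.Build B^c base_ext
     base_ext_scaleA base_ext_scale1 base_ext_scaleDr base_ext_scaleDl).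

(** The element m (x) 1. *)
Definition base_ext_pure (m : M) : base_ext_lmod :=
  [ffun i => (coord i 1 : A^c) *: m].

Lemma base_ext_pureD m m' : base_ext_pure (m + m') = base_ext_pure m + base_ext_pure m'.
Proof. by apply/ffunP => i; rewrite !ffunE scalerDr. Qed.

Lemma base_ext_pureZ m (a : A) :
  base_ext_pure ((a : A^c) *: m) = (phi a : B^c) *: base_ext_pure m.
Proof.
apply/ffunP => j; rewrite !ffunE.
under eq_bigr => i _ do rewrite ffunE scalerA.
rewrite -scaler_suml scalerA; congr (_ *: _).
change (a * coord j (1 : B) = \sum_l coord l 1 * coord j (b l * (phi a : B))).
by rewrite sum_coord mul1r -[phi a]mulr1 coordM.
Qed.

End Extend.

Section ExtendMap.
Variables (M N : lmodType A^c) (f : {linear M -> N}).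

Definition base_ext_map (m : base_ext_lmod M) : base_ext_lmod N :=
  [ffun i => f ((m : {ffun I -> M}) i)].

Fact base_ext_map_linear : linear base_ext_map.
Proof.
move=> x m m'; apply/ffunP => j; rewrite !ffunE raddfD raddf_sum.
congr (_ + _); apply: eq_bigr => i _ /=; rewrite ffunE; by rewrite linearZ_LR.
Qed.

HB.instance Definition _ := GRing.isLinear.Build B^c (base_ext_lmod M)
  (base_ext_lmod N) *:%R base_ext_map base_ext_map_linear.

Lemma base_ext_map_inj : injective f -> injective base_ext_map.
Proof.
move=> f_inj m m' /ffunP mm'; apply/ffunP => i; apply: f_inj.
by have := mm' i; rewrite !ffunE.
Qed.

Lemma base_ext_map_pure m : base_ext_map (base_ext_pure m) = base_ext_pure (f m).
Proof. by apply/ffunP => i; rewrite !ffunE linearZ. Qed.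

End ExtendMap.

Section Descent.
Variables (C : lmodType A) (D : lmodType B).
Variables (j : {additive C -> D}) (pi : {additive D -> C}).
Hypothesis jZ : forall a c, j (a *: c) = phi a *: j c.
Hypothesis piZ : forall a x, pi (phi a *: x) = a *: pi x.
Hypothesis jK : cancel j pi.

Lemma pi_coord x d : \sum_i coord i x *: pi (b i *: d) = pi (x *: d).
Proof.
rewrite [x in RHS]coordK scaler_suml raddf_sum; apply: eq_bigr => i _.
by rewrite -scalerA piZ.
Qed.

Lemma pure_tensor_suml (M : lmodType A^c) (s : I -> M) (c : C) :
  pure_tensor (\sum_i s i) c = \sum_i pure_tensor (s i) c.
Proof.
apply: (big_morph (fun m => pure_tensor m c)) => [m m'|].
  exact: pure_tensorDl.
by apply: (addrI (pure_tensor 0 c)); rewrite -pure_tensorDl !addr0.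
Qed.

Lemma pure_tensor_sumr (M : lmodType A^c) (m : M) (s : I -> C) :
  pure_tensor m (\sum_i s i) = \sum_i pure_tensor m (s i).
Proof.
apply: (big_morph (pure_tensor m)) => [c c'|].
  exact: pure_tensorDr.
by apply: (addrI (pure_tensor m 0)); rewrite -pure_tensorDr !addr0.
Qed.

(** Additive maps out of a tensor product are determined on pure tensors. *)
Lemma tensor_additive_eq (M : lmodType A^c) (Z : zmodType)
    (u v : {additive tensor M C -> Z}) :
  (forall m c, u (pure_tensor m c) = v (pure_tensor m c)) -> u =1 v.
Proof.
move=> uv t; have [s ->] := tensor_gen t; rewrite !raddf_sum.
by apply: eq_bigr => -[z [m c]] _; rewrite !raddfMz uv.
Qed.

(** The map m (x) c |-> (m (x) 1) (x) j c has the left inverse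
    (m (x) b) (x) d |-> m (x) pi (b d), because pi is A-linear and pi (j c) = c.
    So M (x)_A C embeds, naturally in M, in (M (x)_A B) (x)_B D. *)
Lemma base_ext_tensor (M : lmodType A^c) :
  exists alpha : {additive tensor M C -> tensor (base_ext_lmod M) D},
    (forall m c, alpha (pure_tensor m c) = pure_tensor (base_ext_pure m) (j c))
    /\ injective alpha.
Proof.
have [|||alpha alphaE] := @tensor_universal _ M C (tensor (base_ext_lmod M) D)
    (fun m c => pure_tensor (base_ext_pure m) (j c)).
- by move=> m m' c; rewrite base_ext_pureD pure_tensorDl.
- by move=> m c c'; rewrite raddfD pure_tensorDr.
- by move=> m a c; rewrite base_ext_pureZ jZ -pure_tensorZ.
pose beta0 (m : base_ext_lmod M) d :=
  \sum_i pure_tensor ((m : {ffun I -> M}) i) (pi (b i *: d)).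
have [|||beta betaE] :=
    @tensor_universal _ (base_ext_lmod M) D (tensor M C) beta0.
- move=> m m' d; rewrite /beta0 -big_split; apply: eq_bigr => i _ /=.
  by rewrite ffunE pure_tensorDl.
- move=> m d d'; rewrite /beta0 -big_split; apply: eq_bigr => i _ /=.
  by rewrite scalerDr raddfD pure_tensorDr.
- move=> m x d; rewrite /beta0.
  under eq_bigr => i _ do rewrite ffunE pure_tensor_suml.
  rewrite exchange_big; apply: eq_bigr => i _ /=.
  rewrite scalerA -pi_coord pure_tensor_sumr; apply: eq_bigr => l _.
  by rewrite pure_tensorZ.
exists alpha; split=> //; apply: (can_inj (g := beta)) => t.
rewrite -[LHS]/((beta \o alpha) t) -[RHS]/(idfun t).
apply: tensor_additive_eq => {t} m c /=; rewrite alphaE betaE /beta0.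
under eq_bigr => i _ do rewrite ffunE pure_tensorZ.
by rewrite -pure_tensor_sumr pi_coord scale1r jK.
Qed.

(** An injection f gives an injection f^I of the right B-modules M (x)_A B and
    N (x)_A B, here by freeness of B. Tensoring with the flat module D keeps it
    injective, and M (x)_A C sits inside the source by [base_ext_tensor]. *)
Lemma flat_descent : flat_module D -> flat_module C.
Proof.
move=> Dflat M N f f_inj.
have [aM [aME aM_inj]] := base_ext_tensor M.
have [aN [aNE _]] := base_ext_tensor N.
have sq : tensor_map (base_ext_map f) \o aM =1 aN \o tensor_map f.
  apply: tensor_additive_eq => m c.
  by rewrite /= aME !tensor_map_pure aNE -base_ext_map_pure.
move=> t t' tt'; apply/aM_inj/(Dflat _ _ _ (base_ext_map_inj f_inj)).
by rewrite -[LHS]/((_ \o aM) t) -[RHS]/((_ \o aM) t') !sq /= tt'.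
Qed.

End Descent.
End FreeExtension.

(** * Unipotent matrices and Frobenius reciprocity *)

Section UpperUnipotent.
Variables (k : finFieldType) (n : nat).
Local Notation U := (upper_unipotent k n).

Lemma upper_unipotentP (u : {'GL_n[k]}) :
  reflect (forall i j : 'I_n.-1.+1,
             ((j < i)%N -> GLval u i j = 0) /\ (i = j -> GLval u i j = 1))
          (u \in U).
Proof.
rewrite inE; apply: (iffP forallP) => [uP i j|uP i].
  have /forallP/(_ j)/andP[/implyP u0 /implyP u1] := uP i.
  by split=> [/u0/eqP //|/eqP/u1/eqP].
apply/forallP => j; have [u0 u1] := uP i j.
apply/andP; split; apply/implyP; first by move/u0->.
by move/eqP/u1->.
Qed.

Lemma upper_unipotent_group_set : group_set U.
Proof.
apply/group_setP; split=> [|u v /upper_unipotentP uU /upper_unipotentP vU].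
  apply/upper_unipotentP => i j; rewrite GL_1E !mxE; split=> [ji|->].
    by rewrite -val_eqE gtn_eqF.
  by rewrite eqxx.
have u0 (i j : 'I_n.-1.+1) : (j < i)%N -> GLval u i j = 0 by case: (uU i j).
have v0 (i j : 'I_n.-1.+1) : (j < i)%N -> GLval v i j = 0 by case: (vU i j).
apply/upper_unipotentP => i j; rewrite GL_MxE mxE; split=> [ji|<-].
  rewrite big1 // => l _; have [li|il] := ltnP l i; first by rewrite u0 ?mul0r.
  by rewrite v0 ?mulr0 // (leq_trans ji).
rewrite (bigD1 i) //= big1 => [|l]; last first.
  rewrite -val_eqE neq_ltn => /orP[li|il]; first by rewrite u0 ?mul0r.
  by rewrite v0 ?mulr0.
by rewrite (uU i i).2 // (vU i i).2 // mulr1 addr0.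
Qed.

Definition upper_unipotent_group := Group upper_unipotent_group_set.

Lemma unipotent1 : 1%g \in U.
Proof. exact: (group1 upper_unipotent_group). Qed.
Lemma unipotentM u v : u \in U -> v \in U -> (u * v)%g \in U.
Proof. exact: (@groupM _ upper_unipotent_group). Qed.
Lemma unipotentV u : (u^-1%g \in U) = (u \in U).
Proof. exact: (@groupV _ upper_unipotent_group). Qed.
Lemma unipotentMl u v : u \in U -> ((u * v)%g \in U) = (v \in U).
Proof. exact: (@groupMl _ upper_unipotent_group). Qed.
Lemma unipotentMr u v : u \in U -> ((v * u)%g \in U) = (v \in U).
Proof. exact: (@groupMr _ upper_unipotent_group). Qed.

End UpperUnipotent.

Section Frobenius.
Variables (k : finFieldType) (K : fieldType) (n : nat).
Local Notation G := {'GL_n[k]}.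
Local Notation U := (upper_unipotent k n).
Local Notation C := (ind_rep k K n).
Local Notation act := (@right_action k K n).
Local Notation translate := right_translate.
Local Notation H := (equiv_end act).
Implicit Types (F : C) (g x u : G) (a : H).

Lemma ind_repU F u g : u \in U -> F (u * g)%g = F g.
Proof. by move=> uU; have /left_invariantP -> := ind_repP F. Qed.

Lemma ind_rep_eq F F' : (forall g, F g = F' g) -> F = F'.
Proof. by move=> FF'; apply/val_inj/ffunP. Qed.

Lemma ind_rep0E g : (0 : C) g = 0. Proof. by rewrite ffunE. Qed.
Lemma ind_repDE F F' g : (F + F') g = F g + F' g. Proof. by rewrite ffunE. Qed.
Lemma ind_repBE F F' g : (F - F') g = F g - F' g. Proof. by rewrite !ffunE. Qed.
Lemma ind_repZE c F g : (c *: F) g = c * F g. Proof. by rewrite ffunE. Qed.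
Lemma ind_rep_sumE I (r : seq I) P (E : I -> C) g :
  (\sum_(i <- r | P i) E i) g = \sum_(i <- r | P i) E i g.
Proof.
apply: (big_morph (fun F : C => F g)) => [F F'|]; first exact: ind_repDE.
exact: ind_rep0E.
Qed.

Lemma right_actE g F x : translate g F x = F (x * g)%g.
Proof. by rewrite ffunE. Qed.

Lemma right_actM g h F : translate g (translate h F) = translate (g * h)%g F.
Proof. by apply: ind_rep_eq => x; rewrite !right_actE mulgA. Qed.

Lemma unipotent_indicator_subproof :
  left_invariant [ffun g : G => (g \in U)%:R : K^o].
Proof. by apply/left_invariantP => u g uU; rewrite !ffunE unipotentMl. Qed.

Definition unipotent_indicator : C := IndRep unipotent_indicator_subproof.

Lemma unipotent_indicatorE g : unipotent_indicator g = (g \in U)%:R.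
Proof. by rewrite ffunE. Qed.

Lemma unipotent_indicator_inv u :
  u \in U -> translate u unipotent_indicator = unipotent_indicator.
Proof.
move=> uU; apply: ind_rep_eq => x.
by rewrite right_actE !unipotent_indicatorE unipotentMr.
Qed.

Section Average.
Variable V : lmodType K.

(** A sum over U \ G, for functions constant on right cosets of U. Summing over
    G and dividing by #|U| is impossible: #|U| is a power of the characteristic
    of k, which is zero in any field containing k. *)
Definition coset_sum (T : G -> V) : V :=
  \sum_(X in rcosets U [set: G]) T (repr X).

Definition coset_inv (T : G -> V) := forall u g, u \in U -> T (u * g)%g = T g.

Lemma repr_rcosetU (T : G -> V) g : coset_inv T -> T (repr (U :* g)%g) = T g.
Proof.
move=> TU.
have /rcosetP[u uU ->] := mem_repr_rcoset (upper_unipotent_group k n) g.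
exact: TU.
Qed.

Lemma coset_sumM (T : G -> V) h : coset_inv T ->
  coset_sum (fun g => T (g * h)%g) = coset_sum T.
Proof.
move=> TU; rewrite /coset_sum [RHS](reindex_onto (fun X : {set G} => X :* h)%g
  (fun X : {set G} => X :* h^-1)%g) /=; last by move=> X _; rewrite rcosetKV.
apply: eq_big => [X|X].
  rewrite rcosetK eqxx andbT; apply/rcosetsP/rcosetsP => -[g _].
    by move=> ->; exists (g * h)%g; rewrite ?inE // rcosetM.
  move=> XE; exists (g * h^-1)%g; rewrite ?inE //.
  by rewrite rcosetM -XE rcosetK.
case/rcosetsP => g _ ->; rewrite -rcosetM (repr_rcosetU (g * h) TU).
rewrite (@repr_rcosetU (fun x => T (x * h)%g)) // => u x uU.
by rewrite -mulgA; apply: TU.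
Qed.

Lemma coset_sum_eq (T T' : G -> V) : T =1 T' -> coset_sum T = coset_sum T'.
Proof. by move=> TT'; apply: eq_bigr => X _. Qed.

Lemma coset_sum_supported (T : G -> V) : coset_inv T ->
  (forall g, g \notin U -> T g = 0) -> coset_sum T = T 1%g.
Proof.
move=> TU T0; rewrite /coset_sum (bigD1 (U : {set G})) /=; last first.
  by apply/rcosetsP; exists 1%g; rewrite ?inE // mulg1.
rewrite big1 ?addr0 => [|X /andP[/rcosetsP[g _ ->]] XU].
  by have := repr_rcosetU 1 TU; rewrite mulg1.
rewrite repr_rcosetU // T0 //; apply: contra XU => gU.
by apply/eqP; apply: (@rcoset_id _ (upper_unipotent_group k n)).
Qed.

End Average.

Definition U_invariant (F : C) := forall u, u \in U -> translate u F = F.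

(** The endomorphism sending the indicator of U to v: by
    [unipotent_indicator_gen], F is the sum of the F g *: g^-1 1_U over U \ G. *)
Definition frobenius_fun (v : C) (F : C) : C :=
  coset_sum (fun g => (F g : K) *: translate g^-1%g v).

Lemma frobenius_inv v F : U_invariant v ->
  coset_inv (fun g => (F g : K) *: translate g^-1%g v).
Proof.
move=> vU u g uU; rewrite ind_repU // invMg -right_actM vU //.
by rewrite unipotentV.
Qed.

Lemma frobenius_equivariant v :
  U_invariant v -> equivariant act (frobenius_fun v).
Proof.
move=> vU; apply/asboolP; split=> [c F F'|h F];
  last rewrite -[act h _]/(translate h _) -[act h _]/(translate h _).
  rewrite /frobenius_fun /coset_sum scaler_sumr -big_split; apply: eq_bigr => X _.
  by rewrite ind_repDE ind_repZE scalerDl scalerA.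
rewrite /frobenius_fun {2}/coset_sum raddf_sum.
rewrite -[RHS]/(coset_sum
  (fun g => translate h ((F g : K) *: translate g^-1%g v))).
rewrite -[RHS](coset_sumM h) => [|u g uU]; last first.
  by rewrite (frobenius_inv F vU).
by apply: coset_sum_eq => g; rewrite right_actE linearZ /= right_actM
  invMg mulKVg.
Qed.

Definition frobenius v (vU : U_invariant v) : H :=
  EquivEnd (frobenius_equivariant vU).

Lemma frobenius_indicator v (vU : U_invariant v) :
  frobenius vU unipotent_indicator = v.
Proof.
rewrite /= /frobenius_fun coset_sum_supported.
- rewrite unipotent_indicatorE unipotent1 scale1r; apply: ind_rep_eq => x.
  by rewrite right_actE invg1 mulg1.
- exact: frobenius_inv.
- by move=> g gU; rewrite unipotent_indicatorE (negPf gU) scale0r.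
Qed.

Lemma unipotent_indicator_gen F :
  F = coset_sum (fun g => (F g : K) *: translate g^-1%g unipotent_indicator).
Proof.
apply: ind_rep_eq => x; rewrite ind_rep_sumE.
pose T g : K^o := F g * unipotent_indicator (x * g^-1)%g.
have TU : coset_inv T.
  move=> u g uU; rewrite /T ind_repU // invMg mulgA unipotent_indicatorE.
  by rewrite unipotentMr ?unipotentV // -unipotent_indicatorE.
transitivity (coset_sum T); last first.
  by apply: eq_bigr => X _; rewrite ind_repZE right_actE.
rewrite -(coset_sumM x TU) coset_sum_supported.
- by rewrite /T mul1g mulgV unipotent_indicatorE unipotent1 mulr1.
- by move=> u g uU; rewrite -mulgA; apply: TU.
- move=> g gU.
  by rewrite /T invMg mulKVg unipotent_indicatorE unipotentV (negPf gU) mulr0.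
Qed.

Lemma hecke_sum a I (r : seq I) P (E : I -> C) :
  a (\sum_(i <- r | P i) E i) = \sum_(i <- r | P i) a (E i).
Proof.
have aD F F' : a (F + F') = a F + a F'.
  by have /(_ 1 F F') := equiv_end_linear a; rewrite !scale1r.
apply: (big_morph a) => //.
by apply: (addrI (a 0)); rewrite -aD !addr0.
Qed.

Lemma hecke0 a : a 0 = 0.
Proof. by have := @hecke_sum a void [::] xpredT (fun=> 0); rewrite !big_nil. Qed.

Lemma heckeZ a c F : a (c *: F) = c *: a F.
Proof. by have := equiv_end_linear a c F 0; rewrite hecke0 !addr0. Qed.

Lemma hecke_tr a g F : a (translate g F) = translate g (a F).
Proof. exact: equiv_end_act. Qed.

Lemma hecke_indicator_inv a : U_invariant (a unipotent_indicator).
Proof. by move=> u uU; rewrite -hecke_tr unipotent_indicator_inv. Qed.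

(** The indicator of U generates the induced representation. With
    [frobenius_indicator], this identifies the Hecke algebra with the
    U-invariant functions, by evaluation at the indicator. *)
Lemma hecke_eq a a' : a unipotent_indicator = a' unipotent_indicator -> a = a'.
Proof.
move=> aa'; apply: equiv_end_eq => F.
rewrite (unipotent_indicator_gen F) !hecke_sum.
by apply: eq_bigr => X _; rewrite !heckeZ !hecke_tr aa'.
Qed.

End Frobenius.

(** * The Hecke algebra of a Levi factor *)

(** The images iota G and the group U' generate a parabolic subgroup P = U' iota G
    with Levi factor G, and the d i represent the double cosets P \ G' / U'. The
    hypotheses say that U' acts on U' \ P = U \ G through U, that the double
    cosets are disjoint and cover G', and that the image in G of the
    intersection of P with d i U' (d i)^-1 is exactly U for every i. The last
    point makes every double coset contribute one copy of A to B. *)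
Section ParabolicTransfer.
Variables (k : finFieldType) (K : fieldType) (n n' : nat) (I : finType).
Local Notation G := {'GL_n[k]}.
Local Notation G' := {'GL_n'[k]}.
Local Notation U := (upper_unipotent k n).
Local Notation U' := (upper_unipotent k n').
Local Notation C := (ind_rep k K n).
Local Notation D := (ind_rep k K n').
Local Notation translate := right_translate.
Local Notation A := (equiv_end (@right_action k K n)).
Local Notation B := (equiv_end (@right_action k K n')).

Variables (iota : G -> G') (d : I -> G').
Hypothesis iotaM : forall x y, iota (x * y)%g = (iota x * iota y)%g.
Hypothesis iotaU : forall x, (iota x \in U') = (x \in U).
Hypothesis iota_unipotent : forall u, u \in U' ->
  exists2 y, y \in U & forall x, (iota x * u * (iota (x * y))^-1)%g \in U'.
Hypothesis d_cover : forall g : G', exists i u x v,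
  [/\ u \in U', v \in U' & g = (u * iota x * d i * v)%g].
Hypothesis d_disjoint : forall i i' x u v, u \in U' -> v \in U' ->
  (u * iota x * d i * v)%g = d i' -> i = i' /\ x \in U.
Hypothesis d_conj : forall i x, x \in U -> ((d i)^-1 * iota x * d i)%g \in U'.

Lemma iota1 : iota 1%g = 1%g.
Proof. by apply: (mulgI (iota 1)); rewrite -iotaM !mulg1. Qed.

Lemma iotaV x : iota x^-1 = (iota x)^-1%g.
Proof. by apply: (mulgI (iota x)); rewrite mulgV -iotaM mulgV iota1. Qed.

(** Slices present a function on U' \ G' as a P-equivariant function from G' to
    the functions on U \ G; this is D = Ind_P C. *)
Lemma slice_subproof g (F : D) :
  left_invariant [ffun x : G => F (iota x * g)%g].
Proof.
apply/left_invariantP => u x uU.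
by rewrite !ffunE iotaM -mulgA; apply: ind_repU; rewrite iotaU.
Qed.

Definition slice g (F : D) : C := IndRep (slice_subproof g F).

Lemma sliceE g F x : slice g F x = F (iota x * g)%g.
Proof. by rewrite ffunE. Qed.

Fact slice_linear g : linear (slice g).
Proof. by move=> c F F'; apply: ind_rep_eq => x; rewrite !ffunE. Qed.

HB.instance Definition _ g :=
  GRing.isLinear.Build K D C *:%R (slice g) (slice_linear g).

Lemma slice1 g F : slice g F 1%g = F g.
Proof. by rewrite sliceE iota1 mul1g. Qed.

Lemma slice_iota y g F : slice (iota y * g)%g F = translate y (slice g F).
Proof. by apply: ind_rep_eq => x; rewrite right_actE !sliceE iotaM mulgA. Qed.

Lemma slice_unipotent u g : u \in U' ->
  exists2 y, y \in U & forall F, slice (u * g)%g F = translate y (slice g F).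
Proof.
move=> uU'; have [y yU yP] := iota_unipotent uU'; exists y => // F.
apply: ind_rep_eq => x; rewrite right_actE !sliceE.
by rewrite mulgA -[RHS](ind_repU _ _ (yP x)) !mulgA mulgKV.
Qed.

Lemma slice_right g h F : slice g (translate h F) = slice (g * h)%g F.
Proof. by apply: ind_rep_eq => x; rewrite !sliceE right_actE mulgA. Qed.

Lemma slice_eq F F' : (forall g, slice g F = slice g F') -> F = F'.
Proof. by move=> FF'; apply: ind_rep_eq => g; rewrite -!slice1 FF'. Qed.

(** A acts on D = Ind_P C by functoriality of induction. *)
Lemma hecke_embed_subproof (a : A) (F : D) :
  left_invariant [ffun g : G' => a (slice g F) 1%g].
Proof.
apply/left_invariantP => u g /(slice_unipotent g)[y yU uE].
by rewrite !ffunE uE hecke_tr right_actE mul1g -[y]mulg1 ind_repU.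
Qed.

Definition hecke_embed_fun (a : A) (F : D) : D :=
  IndRep (hecke_embed_subproof a F).

Lemma slice_hecke_embed_fun a F g :
  slice g (hecke_embed_fun a F) = a (slice g F).
Proof.
apply: ind_rep_eq => x; rewrite sliceE ffunE slice_iota hecke_tr right_actE.
by rewrite mul1g.
Qed.

Lemma hecke_embed_equivariant a :
  equivariant (@right_action k K n') (hecke_embed_fun a).
Proof.
apply/asboolP; split=> [c F F'|h F]; apply: slice_eq => g.
  by rewrite linearP /= !slice_hecke_embed_fun linearP /= equiv_end_linear.
rewrite -[right_action _ h F]/(translate h F).
rewrite -[right_action _ h _]/(translate h _).
by rewrite slice_hecke_embed_fun !slice_right slice_hecke_embed_fun.
Qed.

Definition hecke_embed (a : A) : B := EquivEnd (hecke_embed_equivariant a).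

Lemma slice_hecke_embed a F g : slice g (hecke_embed a F) = a (slice g F).
Proof. exact: slice_hecke_embed_fun. Qed.

Lemma slice_d_inv i (F : D) : U_invariant F -> U_invariant (slice (d i) F).
Proof.
move=> FU x xU; rewrite -slice_iota.
have -> : (iota x * d i = d i * ((d i)^-1 * iota x * d i))%g.
  by rewrite !mulgA mulgV mul1g.
by rewrite -slice_right FU ?d_conj.
Qed.

(** A U'-invariant element of D = Ind_P C is determined by its values at
    representatives of P \ G' / U'. *)
Lemma slice_d_eq (F F' : D) : U_invariant F -> U_invariant F' ->
  (forall i, slice (d i) F = slice (d i) F') -> F = F'.
Proof.
move=> FU F'U FF'; apply: ind_rep_eq => g.
have [i [u [x [v [uU vU ->]]]]] := d_cover g.
rewrite -!mulgA !(ind_repU _ _ uU) !mulgA -!(right_actE v) FU // F'U //.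
by rewrite -!sliceE FF'.
Qed.

(** B is the space of U'-invariants of D, by evaluation at the indicator of U';
    at d i such an invariant takes a U-invariant value in C, that is, an element
    of A. *)
Definition coord i (b : B) : A :=
  frobenius (@slice_d_inv i _ (hecke_indicator_inv b)).

Lemma coord_indicator i b :
  coord i b (unipotent_indicator k K n) =
  slice (d i) (b (unipotent_indicator k K n')).
Proof. exact: frobenius_indicator. Qed.

Fact coord_zmod_morphism i : zmod_morphism (coord i).
Proof.
move=> b b'; apply: hecke_eq; rewrite coord_indicator.
rewrite -[RHS]/(coord i b _ - coord i b' _) !coord_indicator.
exact: (raddfB (slice (d i))).
Qed.

HB.instance Definition _ i :=
  GRing.isZmodMorphism.Build B A (coord i) (coord_zmod_morphism i).

Lemma coordM i a b : coord i (hecke_embed a * b) = a * coord i b.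
Proof.
apply: hecke_eq; rewrite coord_indicator.
rewrite -[RHS]/(a (coord i b _)) coord_indicator.
exact: slice_hecke_embed.
Qed.

Definition double_coset i (g : G') :=
  [exists u in U', exists v in U', g == (u * d i * v)%g].

Lemma double_cosetP i g :
  reflect (exists u v, [/\ u \in U', v \in U' & g = (u * d i * v)%g])
          (double_coset i g).
Proof.
apply: (iffP exists_inP) => [[u uU /exists_inP[v vU /eqP->]]|].
  by exists u, v.
case=> u [v [uU vU ->]]; exists u => //; apply/exists_inP; by exists v.
Qed.

Lemma double_cosetU i u g v : u \in U' -> v \in U' ->
  double_coset i (u * g * v)%g = double_coset i g.
Proof.
have gen a b h : a \in U' -> b \in U' ->
    double_coset i h -> double_coset i (a * h * b)%g.
  move=> aU bU /double_cosetP[u' [v' [uU vU ->]]]; apply/double_cosetP.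
  by exists (a * u')%g, (v' * b)%g; split; rewrite ?unipotentM // !mulgA.
move=> uU vU; apply/idP/idP; last exact: gen.
move=> /(gen u^-1 v^-1)%g; rewrite !unipotentV => /(_ uU vU).
by rewrite !mulgA mulVg mul1g mulgK.
Qed.

Lemma basis_fun_subproof i :
  left_invariant [ffun g : G' => (double_coset i g)%:R : K^o].
Proof.
apply/left_invariantP => u g uU; rewrite !ffunE.
by rewrite -[(u * g)%g]mulg1 double_cosetU ?unipotent1.
Qed.

(** The indicator of U' d i U', whose only nonzero value at the d j is the unit
    of A, at j = i. *)
Definition basis_fun i : D := IndRep (basis_fun_subproof i).

Lemma basis_fun_inv i : U_invariant (basis_fun i).
Proof.
move=> u uU; apply: ind_rep_eq => g; rewrite right_actE !ffunE.
by rewrite -[(g * u)%g]mul1g mulgA double_cosetU ?unipotent1.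
Qed.

Definition basis i : B := frobenius (@basis_fun_inv i).

Lemma slice_basis i j :
  slice (d i) (basis_fun j) = if i == j then unipotent_indicator k K n else 0.
Proof.
apply: ind_rep_eq => x; rewrite sliceE ffunE.
have -> : double_coset j (iota x * d i)%g = (i == j) && (x \in U).
  apply/double_cosetP/andP => [[u [v [uU vU E]]]|[/eqP-> xU]]; last first.
    by exists (iota x), 1%g; rewrite iotaU unipotent1 mulg1.
  have [|||-> xU] := @d_disjoint i j x u^-1%g v^-1%g; rewrite ?unipotentV //.
  by rewrite -!mulgA (mulgA (iota x)) E !mulgA mulVg mul1g mulgK.
by case: eqP => _; rewrite ?unipotent_indicatorE ?ind_rep0E.
Qed.

Lemma coord_basis i j : coord i (basis j) = (i == j)%:R.
Proof.
apply: hecke_eq; rewrite coord_indicator frobenius_indicator slice_basis.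
by case: eqP.
Qed.

Lemma coord_sum b : b = \sum_i hecke_embed (coord i b) * basis i.
Proof.
apply: hecke_eq.
have sumE (E : I -> B) F : (\sum_i E i) F = \sum_i E i F.
  by apply: (big_morph (fun b : B => b F)).
have -> :
    (\sum_i hecke_embed (coord i b) * basis i) (unipotent_indicator k K n') =
    \sum_i hecke_embed (coord i b) (basis_fun i).
  rewrite sumE; apply: eq_bigr => i _.
  rewrite -[LHS]/(hecke_embed (coord i b)
    (basis i (unipotent_indicator k K n'))).
  by rewrite frobenius_indicator.
apply: slice_d_eq => [|u uU|i]; first exact: hecke_indicator_inv.
  rewrite raddf_sum; apply: eq_bigr => i _.
  by rewrite -[LHS]/(translate u (hecke_embed _ _)) -hecke_tr basis_fun_inv.
rewrite raddf_sum (bigD1 i) //= big1 => [|l li].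
  by rewrite slice_hecke_embed slice_basis eqxx coord_indicator addr0.
rewrite slice_hecke_embed slice_basis eq_sym (negPf li).
by rewrite hecke0.
Qed.

(** Extension by zero from P to G', a section of the slice at 1: the default
    branch is the complement of P, and the choice of y is immaterial since y is
    unique modulo U. *)
Definition extend0_val (c : C) (g : G') : K :=
  if [pick y | (g * (iota y)^-1)%g \in U'] is Some y then c y else 0.

Lemma extend0_valU c u g : u \in U' -> extend0_val c (u * g)%g = extend0_val c g.
Proof.
move=> uU; rewrite /extend0_val; congr (if _ is Some y then c y else 0).
by apply: eq_pick => y /=; rewrite -mulgA unipotentMl.
Qed.

Lemma extend0_subproof (c : C) :
  left_invariant [ffun g : G' => extend0_val c g : K^o].
Proof. by apply/left_invariantP => u g uU; rewrite !ffunE extend0_valU. Qed.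

Definition extend0 (c : C) : D := IndRep (extend0_subproof c).

Lemma extend0_iota c y : extend0 c (iota y) = c y.
Proof.
rewrite ffunE /extend0_val; case: pickP => [z|/(_ y)]; last first.
  by rewrite mulgV unipotent1.
rewrite -iotaV -iotaM iotaU => yzU.
by rewrite -(ind_repU c z yzU) mulgKV.
Qed.

(** The slices of an extension by zero are translates on P and vanish off P, so
    they commute with A; hence extension by zero is A-linear. *)
Lemma slice_extend0 g :
  (exists y, forall c, slice g (extend0 c) = translate y c) \/
  (forall c, slice g (extend0 c) = 0).
Proof.
case: (pickP (fun y => (g * (iota y)^-1)%g \in U')) => [y gy|g0].
  have [z zU zE] := slice_unipotent (iota y) gy.
  left; exists (z * y)%g => c; rewrite -[g](mulgKV (iota y)) zE -right_actM.
  congr (translate z _); apply: ind_rep_eq => x.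
  by rewrite sliceE -iotaM extend0_iota right_actE.
right=> c; apply: ind_rep_eq => x; rewrite sliceE ffunE /extend0_val ind_rep0E.
case: pickP => // y yU.
have [z zU /(_ x^-1%g) zE] := iota_unipotent yU.
have /negP[] := negbT (g0 (x^-1 * z * y)%g); move: zE.
by rewrite (iotaM _ y) invMg iotaV -!mulgA mulKg.
Qed.

Fact extend0_zmod_morphism : zmod_morphism extend0.
Proof.
move=> c c'; apply: ind_rep_eq => g; rewrite ind_repBE !ffunE /extend0_val.
by case: pickP => [y _|_]; rewrite ?ind_repBE ?subrr.
Qed.

HB.instance Definition _ :=
  GRing.isZmodMorphism.Build C D extend0 extend0_zmod_morphism.

Lemma extend0Z (a : A) (c : C) : extend0 (a c) = hecke_embed a (extend0 c).
Proof.
apply: slice_eq => g; rewrite slice_hecke_embed.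
case: (slice_extend0 g) => [[y yE]|g0]; first by rewrite !yE hecke_tr.
by rewrite !g0 hecke0.
Qed.

Lemma extend0K : cancel extend0 (slice 1).
Proof.
by move=> c; apply: ind_rep_eq => x; rewrite sliceE mulg1 extend0_iota.
Qed.

Lemma flat_parabolic_descent :
  flat_module (hecke_module k K n') -> flat_module (hecke_module k K n).
Proof.
pose j : {additive hecke_module k K n -> hecke_module k K n'} := extend0.
pose pi : {additive hecke_module k K n' -> hecke_module k K n} := slice 1.
apply: (@flat_descent (hecke k K n) (hecke k K n') hecke_embed I basis coord
  coordM coord_sum coord_basis _ _ j pi).
- exact: extend0Z.
- by move=> a x; apply: slice_hecke_embed.
- exact: extend0K.
Qed.

End ParabolicTransfer.

(** * The maximal parabolic subgroup fixing a basis vector *)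

Section Matrices.
Variables (k : finFieldType) (m : nat).
Local Notation G := {'GL_m.+1[k]}.
Local Notation G' := {'GL_m.+2[k]}.
Local Notation U := (upper_unipotent k m.+1).
Local Notation U' := (upper_unipotent k m.+2).

Lemma unitmx_unipotent n (w : 'M[k]_n) :
  (forall i j : 'I_n, (j < i)%N -> w i j = 0) -> (forall i, w i i = 1) ->
  w \in unitmx.
Proof.
move=> w0 w1; rewrite unitmxE -det_tr det_trig => [|]; last first.
  by apply/is_trig_mxP => i j ij; rewrite mxE w0.
by rewrite big1 ?unitr1 // => i _; rewrite mxE w1.
Qed.

Lemma GL_mx n (w : 'M[k]_n.+1) : w \in unitmx ->
  exists u : {'GL_n.+1[k]}, GLval u = w.
Proof. by move=> wU; exists (FinRing.Unit wU). Qed.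

(** G sits in the lower right corner, where the block size 1 + m.+1 is
    convertible to m.+2. *)
Lemma lift0_unit (x : G) : lift0_mx (GLval x) \in unitmx.
Proof.
by rewrite unitmxE /lift0_mx (@det_ublock _ 1) det1 mul1r -unitmxE GL_unitmx.
Qed.

Definition levi_embed (x : G) : G' := FinRing.Unit (lift0_unit x).

Lemma levi_embedE x :
  GLval (levi_embed x) = block_mx 1 0 0 (GLval x) :> 'M_(1 + m.+1).
Proof. by []. Qed.

(** The first column is the first basis vector; such matrices form P. *)
Definition fixes_e0 (p : 'M[k]_m.+2) := forall a, p a 0 = (a == 0)%:R.

Definition levi_block (p : 'M[k]_m.+2) : 'M[k]_m.+1 :=
  \matrix_(a, b) p (lift 0 a) (lift 0 b).

Lemma levi_embed_fixes x : fixes_e0 (GLval (levi_embed x)).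
Proof.
move=> a; rewrite levi_embedE mxE split1; case: unliftP => [a'|] -> /=;
  by rewrite mxE split1 unlift_none /= !mxE.
Qed.

Lemma levi_embed_row0 x b : GLval (levi_embed x) 0 (lift 0 b) = 0.
Proof.
by rewrite levi_embedE mxE split1 unlift_none /= mxE split1 liftK /= mxE.
Qed.

Lemma levi_embed_block x : levi_block (GLval (levi_embed x)) = GLval x.
Proof.
apply/matrixP => a b.
by rewrite mxE levi_embedE mxE split1 liftK /= mxE split1 liftK.
Qed.

Lemma mulmx_fixes (p q : 'M[k]_m.+2) a : fixes_e0 q -> (p *m q) a 0 = p a 0.
Proof.
move=> q0; rewrite mxE (bigD1 0) //= q0 eqxx mulr1 big1 ?addr0 // => l l0.
by rewrite q0 (negPf l0) mulr0.
Qed.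

Lemma levi_blockM (p q : 'M[k]_m.+2) : fixes_e0 p ->
  levi_block (p *m q) = levi_block p *m levi_block q.
Proof.
move=> p0; apply/matrixP => a b; rewrite !mxE big_ord_recl p0 mul0r add0r.
by apply: eq_bigr => l _; rewrite !mxE.
Qed.

Lemma fixes_e0_eq p q : fixes_e0 p -> fixes_e0 q ->
  (forall a, p 0 (lift 0 a) = q 0 (lift 0 a)) ->
  levi_block p = levi_block q -> p = q.
Proof.
move=> p0 q0 pq0 /matrixP pq; apply/matrixP => a b.
case: (unliftP 0 b) => [b'|] ->; last by rewrite p0 q0.
case: (unliftP 0 a) => [a'|] ->; last exact: pq0.
by have := pq a' b'; rewrite !mxE.
Qed.

Lemma levi_embedM x y : levi_embed (x * y)%g = (levi_embed x * levi_embed y)%g.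
Proof.
have x0 := levi_embed_fixes; apply/val_inj/fixes_e0_eq.
- exact: x0.
- move=> a; rewrite -[LHS]/((GLval (levi_embed x) *m GLval (levi_embed y)) a 0).
  by rewrite mulmx_fixes; apply: x0.
- move=> a; rewrite -[RHS]/((GLval (levi_embed x) *m GLval (levi_embed y)) _ _).
  rewrite [LHS]levi_embed_row0 mxE big1 // => l _.
  case: (unliftP 0 l) => [l'|] ->.
    by rewrite levi_embed_row0 mul0r.
  by rewrite levi_embed_row0 mulr0.
rewrite -[RHS]/(levi_block (GLval (levi_embed x) *m GLval (levi_embed y))).
by rewrite levi_blockM // !levi_embed_block.
Qed.

Lemma unipotent_block (p : G') : p \in U' <-> fixes_e0 (GLval p) /\
  forall a b : 'I_m.+1, ((b < a)%N -> levi_block (GLval p) a b = 0)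
    /\ (a = b -> levi_block (GLval p) a b = 1).
Proof.
split=> [/upper_unipotentP pU|[p0 pU]].
  split=> [a|a b].
    have [->|a0] := eqVneq a 0; first by rewrite (pU 0 0).2.
    by rewrite (pU a 0).1 // lt0n.
  rewrite mxE; split=> [ba|->]; last by rewrite (pU _ _).2.
  by rewrite (pU _ _).1.
apply/upper_unipotentP => a b; case: (unliftP 0 b) => [b'|] ->.
  case: (unliftP 0 a) => [a'|] -> //.
  have [u0 u1] := pU a' b'; move: u0 u1; rewrite mxE => u0 u1.
  by split=> [/u0|/lift_inj/u1].
by rewrite p0; split=> [|->]; [rewrite lt0n -val_eqE => /negPf -> | rewrite eqxx].
Qed.

(** P = U' G: dividing p by its lower right block leaves a unipotent matrix. *)
Lemma parabolic_decomp (p : G') : fixes_e0 (GLval p) ->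
  exists2 y : G, GLval y = levi_block (GLval p) & (p * (levi_embed y)^-1)%g \in U'.
Proof.
move=> p0.
have pV : levi_block (GLval p) *m levi_block (GLval p^-1%g) = 1%:M.
  rewrite -levi_blockM // -[_ *m _]/(GLval (p * p^-1)%g) mulgV.
  by apply/matrixP => a b; rewrite !mxE (inj_eq lift_inj).
have [y yE] := GL_mx (proj1 (mulmx1_unit pV)).
exists y => //; set u := (p * _)%g.
have uE : p = (u * levi_embed y)%g by rewrite mulgKV.
clearbody u.
have u0 : fixes_e0 (GLval u).
  move=> a; rewrite -(p0 a) uE GL_MxE mulmx_fixes //; exact: levi_embed_fixes.
have ub : levi_block (GLval u) = 1%:M.
  apply: (can_inj (mulmxK (GL_unitmx y))); rewrite mul1mx [RHS]yE uE GL_MxE.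
  by rewrite levi_blockM // levi_embed_block.
apply/unipotent_block; split=> // a b; rewrite ub !mxE.
by split=> [ba|->]; rewrite ?eqxx // -val_eqE gtn_eqF.
Qed.

Lemma levi_embedU x : (levi_embed x \in U') = (x \in U).
Proof.
apply/idP/upper_unipotentP => [/unipotent_block[_ +] i j|xU].
  by move=> /(_ i j); rewrite levi_embed_block.
apply/unipotent_block; split=> [|i j]; first exact: levi_embed_fixes.
by rewrite levi_embed_block.
Qed.

Lemma levi_embed_unipotent u : u \in U' -> exists2 y, y \in U &
  forall x, (levi_embed x * u * (levi_embed (x * y))^-1)%g \in U'.
Proof.
move=> /unipotent_block[u0 uU]; have [y yE _] := parabolic_decomp u0.
exists y => [|x]; first by apply/upper_unipotentP; rewrite yE.
have xu0 : fixes_e0 (GLval (levi_embed x * u)%g).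
  by move=> a; rewrite GL_MxE mulmx_fixes // levi_embed_fixes.
have [z zE zU] := parabolic_decomp xu0; suff -> : (x * y)%g = z by [].
apply/val_inj; rewrite [RHS]zE GL_MxE levi_blockM; last exact: levi_embed_fixes.
by rewrite levi_embed_block -yE.
Qed.

Lemma fixes_e0V (p : G') : fixes_e0 (GLval p) -> fixes_e0 (GLval p^-1%g).
Proof.
move=> p0 a; rewrite -(mulmx_fixes (GLval p^-1%g) a p0).
by rewrite -[_ *m _]/(GLval (p^-1 * p)%g) mulVg GL_1E mxE.
Qed.

(** The coset P g is determined by the first column of g^-1, and U' acts on
    columns by row operations towards smaller indices. So an orbit is given by
    the position j of the last nonzero entry and by its value, of which the
    second component of the index is the inverse. *)
Definition rep_index := ('I_m.+2 * {unit k})%type.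
Implicit Types i : rep_index.

(** The cycle sending 0 to j and increasing on the other indices; because it is
    increasing there, conjugation by it keeps the Levi block upper unipotent. *)
Definition rep_perm i : 'S_m.+2 := lift_perm 0 i.1 1.
Definition rep_coef i (a : 'I_m.+2) : k := if a == 0 then val i.2 else 1.
Definition rep_mx i : 'M[k]_m.+2 :=
  diag_mx (\row_a rep_coef i a) *m perm_mx (rep_perm i).

Lemma rep_coef_neq0 i a : rep_coef i a != 0.
Proof.
rewrite /rep_coef; case: ifP => _; last exact: oner_neq0.
by rewrite -unitfE; apply: valP.
Qed.

Lemma rep_mxE i a b : rep_mx i a b = rep_coef i a * (rep_perm i a == b)%:R.
Proof. by rewrite /rep_mx mul_diag_mx !mxE. Qed.

Lemma rep_mx_unit i : rep_mx i \in unitmx.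
Proof.
rewrite unitmx_mul unitmx_perm andbT unitmxE det_diag unitfE.
by apply/prodf_neq0 => a _; rewrite mxE rep_coef_neq0.
Qed.

Definition rep i : G' := FinRing.Unit (rep_mx_unit i).

Lemma rep_mulmx i (v : 'M[k]_m.+2) a b :
  (rep_mx i *m v) a b = rep_coef i a * v (rep_perm i a) b.
Proof.
rewrite mxE (bigD1 (rep_perm i a)) //= rep_mxE eqxx mulr1 big1 ?addr0 // => l la.
by rewrite rep_mxE eq_sym (negPf la) mulr0 mul0r.
Qed.

Lemma mulmx_rep i (p : 'M[k]_m.+2) a b :
  (p *m rep_mx i) a (rep_perm i b) = p a b * rep_coef i b.
Proof.
rewrite mxE (bigD1 b) //= rep_mxE eqxx mulr1 big1 ?addr0 // => l lb.
by rewrite rep_mxE (inj_eq perm_inj) (negPf lb) !mulr0.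
Qed.

(** Conjugation by a representative permutes and rescales matrix entries. *)
Lemma rep_intertwine i (p v : G') : (p * rep i = rep i * v)%g -> forall a b,
  rep_coef i a * GLval v (rep_perm i a) (rep_perm i b) =
  GLval p a b * rep_coef i b.
Proof.
move=> /(congr1 (GLval (n:=_) (R:=_))) E a b; rewrite -rep_mulmx -mulmx_rep.
by rewrite -[rep_mx i *m _]E.
Qed.

Lemma rep_perm0 i : rep_perm i 0 = i.1.
Proof. exact: lift_perm_id. Qed.
Lemma rep_perm_lift i a : rep_perm i (lift 0 a) = lift i.1 a.
Proof. by rewrite /rep_perm lift_perm_lift perm1. Qed.

Lemma lift_lt (j : 'I_m.+2) (a b : 'I_m.+1) :
  (lift j b < lift j a)%N = (b < a)%N.
Proof. by rewrite !ltnNge /= leq_bump2. Qed.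

Lemma rep_conj_unipotent i x :
  x \in U -> ((rep i)^-1 * levi_embed x * rep i)%g \in U'.
Proof.
move=> xU; set v := (_ * _)%g.
have /rep_intertwine vE : (levi_embed x * rep i = rep i * v)%g.
  by rewrite /v !mulgA mulgV mul1g.
have /upper_unipotentP iU : levi_embed x \in U' by rewrite levi_embedU.
have cK a (y z : k) : rep_coef i a * y = rep_coef i a * z -> y = z.
  exact: (mulfI (rep_coef_neq0 i a)).
apply/upper_unipotentP => a b.
rewrite -[a](permKV (rep_perm i)) -[b](permKV (rep_perm i)).
move: (_ a) (_ b) => {}a {}b; split=> [ba|/perm_inj->]; last first.
  by apply: (cK b); rewrite vE (iU _ _).2 // mul1r mulr1.
apply: (cK a); rewrite vE mulr0.
apply/eqP; rewrite mulf_eq0; apply/orP; left; apply/eqP.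
move: ba; case: (unliftP 0 a) => [a'|] ->; case: (unliftP 0 b) => [b'|] ->.
- by rewrite !rep_perm_lift lift_lt => ba; rewrite (iU _ _).1.
- by rewrite levi_embed_fixes.
- by rewrite levi_embed_row0.
- by rewrite ltnn.
Qed.

(** Column j' of rep i * v equals column j' of p^-1 * rep i', a multiple of the
    first basis vector, while v has a nonzero entry at (j', j'); this forces
    j = j' and equal scalars. Then p is conjugate to v^-1 by rep i. *)
Lemma rep_disjoint i i' x u v : u \in U' -> v \in U' ->
  (u * levi_embed x * rep i * v)%g = rep i' -> i = i' /\ x \in U.
Proof.
move=> uU vU; set p := (u * levi_embed x)%g.
have pE : p = (u * levi_embed x)%g by []; clearbody p => E.
have p0 : fixes_e0 (GLval p).
  have [u0 _] := (unipotent_block u).1 uU.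
  by move=> a; rewrite pE GL_MxE mulmx_fixes //; exact: levi_embed_fixes.
have vP := upper_unipotentP _ vU.
have pV0 := fixes_e0V p0.
have colE a : rep_coef i a * GLval v (rep_perm i a) i'.1 = (a == 0)%:R * val i'.2.
  rewrite -rep_mulmx -[rep_mx i *m _]/(GLval (rep i * v)%g).
  have -> : (rep i * v = p^-1 * rep i')%g by rewrite -E !mulgA mulVg mul1g.
  rewrite -rep_perm0 GL_MxE -[GLval (rep i')]/(rep_mx i') mulmx_rep pV0.
  by rewrite /rep_coef eqxx.
have i1 : i.1 = i'.1.
  apply/eqP/contraT => ii'.
  have := colE ((rep_perm i)^-1%g i'.1); rewrite permKV (vP _ _).2 // mulr1.
  have [E0|_] := eqVneq ((rep_perm i)^-1%g i'.1) 0.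
    by case/eqP: ii'; rewrite -(permKV (rep_perm i) i'.1) E0 rep_perm0.
  by rewrite mul0r => /eqP; rewrite (negPf (rep_coef_neq0 _ _)).
have i2 : i.2 = i'.2.
  apply/val_inj; have := colE 0; rewrite rep_perm0 i1 (vP _ _).2 // mulr1 mul1r.
  by rewrite /rep_coef eqxx.
have ii' : i = i' by rewrite [i]surjective_pairing [i']surjective_pairing i1 i2.
split=> //; rewrite -ii' in E.
have vVU : v^-1%g \in U' by rewrite unipotentV.
have vVP := upper_unipotentP _ vVU.
have /rep_intertwine pvE : (p * rep i = rep i * v^-1)%g by rewrite -{2}E mulgK.
suff pU : p \in U' by rewrite -levi_embedU -(unipotentMl _ uU) -pE.
apply/unipotent_block; split=> // a b.
have := pvE (lift 0 a) (lift 0 b); rewrite /rep_coef /= mul1r mulr1.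
rewrite !rep_perm_lift mxE => <-.
by split=> [ba|->]; [rewrite (vVP _ _).1 ?lift_lt | rewrite (vVP _ _).2].
Qed.

(** Gaussian elimination on the first column of g^-1. *)
Lemma rep_cover (g : G') : exists i u x v,
  [/\ u \in U', v \in U' & g = (u * levi_embed x * rep i * v)%g].
Proof.
pose c a := GLval g^-1%g a 0.
have [j cj jmax] :
    exists2 j, c j != 0 & forall a : 'I_m.+2, (j < a)%N -> c a = 0.
  have [a0 ca0] : exists a, c a != 0.
    apply/existsP; apply: contraT; rewrite negb_exists => /forallP c0.
    have : (GLval g *m GLval g^-1%g) 0 0 = 0.
      by rewrite mxE big1 // => l _; move: (c0 l); rewrite negbK => /eqP cl;
        rewrite -[GLval g^-1%g l 0]/(c l) cl mulr0.
    rewrite -[_ *m _]/(GLval (g * g^-1)%g) mulgV GL_1E mxE => /eqP.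
    by rewrite oner_eq0.
  case: (@arg_maxnP _ a0 (fun a => c a != 0) (fun a : 'I_m.+2 => a : nat) ca0).
  move=> j cj jmax.
  exists j => // a ja; apply/eqP/contraT => /jmax /=; by rewrite leqNgt ja.
(* w is unipotent and c j times its column j is the first column of g^-1. *)
pose w : 'M[k]_m.+2 :=
  \matrix_(a, b) (if b == j then c a / c j else (a == b)%:R).
have w0 (a b : 'I_m.+2) : (b < a)%N -> w a b = 0.
  rewrite mxE => ba; case: eqP => [bj|_]; first by rewrite jmax ?mul0r // -bj.
  by rewrite -val_eqE gtn_eqF.
have w1 a : w a a = 1.
  by rewrite mxE; case: eqP => [->|_]; rewrite ?eqxx // divff.
have [u uE] := GL_mx (unitmx_unipotent w0 w1).
have uU : u \in U'.
  by apply/upper_unipotentP => a b; rewrite uE; split=> [/w0|->].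
have cjV : (c j)^-1 \is a GRing.unit by rewrite unitrV unitfE.
pose i : rep_index := (j, FinRing.Unit cjV).
pose p := (g * u * (rep i)^-1)%g.
have p0 : fixes_e0 (GLval p).
  rewrite -[p]invgK; apply: fixes_e0V => a.
  have -> : p^-1%g = (rep i * (u^-1 * g^-1))%g.
    by rewrite /p !invMg invgK !mulgA.
  pose z : 'cV[k]_m.+2 := \col_l ((l == j)%:R * c j).
  have gz : col 0 (GLval g^-1%g) = GLval u *m z.
    apply/matrixP => l b; rewrite uE !mxE (bigD1 j) //= big1 => [|l' lj].
      by rewrite !mxE !eqxx mul1r addr0 divfK.
    by rewrite !mxE (negPf lj) mul0r mulr0.
  have uz : col 0 (GLval (u^-1 * g^-1)%g) = z.
    by rewrite GL_MxE colE -mulmxA -colE gz GL_VxE mulKmx // GL_unitmx.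
  have uza b : GLval (u^-1 * g^-1)%g b 0 = (b == j)%:R * c j.
    by have /colP/(_ b) := uz; rewrite !mxE.
  have aj : rep_perm i a == j = (a == 0).
    by rewrite -[X in _ == X](rep_perm0 i) (inj_eq perm_inj).
  rewrite GL_MxE rep_mulmx uza aj; case: eqP => [->|_].
    by rewrite /rep_coef eqxx mul1r mulVf.
  by rewrite mul0r mulr0.
have [x _ pxU] := parabolic_decomp p0.
exists i, (p * (levi_embed x)^-1)%g, x, u^-1%g; split=> //.
  by rewrite unipotentV.
by rewrite mulgKV /p mulgKV mulgK.
Qed.

Lemma flat_hecke_module_pred (K : fieldType) :
  flat_module (hecke_module k K m.+2) -> flat_module (hecke_module k K m.+1).
Proof.
exact: (flat_parabolic_descent levi_embedM levi_embedU levi_embed_unipotent rep_cover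
  rep_disjoint rep_conj_unipotent).
Qed.
End Matrices.

Theorem mainTheorem4 (k : finFieldType) (p : nat) (charkp : p \in [pchar k])
    (K : closedFieldType) (iota : {rmorphism k -> K})
    (K_alg : forall x : K, algebraicOver iota x)
    (n0 : nat) (n0_ge1 : (1 <= n0)%N)
    (not_flat_n0 : ~ flat_module (hecke_module k K n0)) :
  forall n : nat, (n0 <= n)%N -> ~ flat_module (hecke_module k K n).
Proof.
case: n0 n0_ge1 not_flat_n0 => // m _ m_nflat; elim=> [|n IHn] //.
rewrite leq_eqVlt => /predU1P[<- //|mn] n_flat; apply: (IHn mn).
by case: n mn n_flat {IHn} => // n _; apply: flat_hecke_module_pred.
Qed.
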